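(* Let $\omega\in[0,1]$ and let $A\in\mathbb{C}^{m\times m}$, $B\in\mathbb{C}^{m\times n}$, $C\in\mathbb{C}^{n\times m}$, $D\in\mathbb{C}^{n\times n}$ be such that the equation $XCX-XD-AX+B=0$ is in class $\mathbb{H}^\omega$, and suppose $Q_\omega\mathbf{1}>0$, where $Q=\begin{pmatrix}D&-C\\-B&A\end{pmatrix}$. Let $A=A_1-A_2$ and $D=D_1-D_2$ be splittings, and let $$\widetilde A=(A_1)_\omega-|A_2|,\quad \widetilde D=(D_1)_\omega-|D_2|,\quad \widetilde B=|B|,\quad \widetilde C=|C|,\quad \widetilde Q=\begin{pmatrix}\widetilde D&-\widetilde C\\-\widetilde B&\widetilde A\end{pmatrix}.$$ If $I\otimes (A_1)_\omega+((D_1)_\omega)^T\otimes I$ is a nonsingular M-matrix, and $\widetilde Q$ is a nonsingular M-matrix satisfying $\widetilde Q\le Q_\omega$ and $\widetilde Q\mathbf{1}>0$, then the sequence $\{\Phi_k\}$ generated by $$\Phi_0=0,\qquad A_1\Phi_{k+1}+\Phi_{k+1}D_1=B+A_2\Phi_k+\Phi_kD_2+\Phi_kC\Phi_k,\quad k\ge0,$$ converges linearly to the extremal solution $\Phi$ of the equation.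
   Context: For a complex square matrix $M$ and a real $\omega\in[0,1]$, the $\omega$-comparison matrix $M_\omega$ is the real matrix with entries $[M_\omega]_{ii}=\omega\,\mathrm{Re}([M]_{ii})+(1-\omega)\,\mathrm{Im}([M]_{ii})$ and $[M_\omega]_{ij}=-|[M]_{ij}|$ for $i\ne j$. A real square matrix $M$ is a nonsingular M-matrix if all its off-diagonal entries are nonpositive and $Mu>0$ for some vector $u>0$. $\mathbf{1}$ is the all-ones column vector; $|M|$ is the matrix of moduli of entries; inequalities between real matrices or vectors are entrywise; $\otimes$ is the Kronecker product. The equation $XCX-XD-AX+B=0$ (unknown $X\in\mathbb{C}^{m\times n}$) is in class $\mathbb{H}^\omega$ if $Q_\omega$ is a nonsingular M-matrix. The extremal solution $\Phi$ is the unique solution such that every eigenvalue $\lambda$ of $D-C\Phi$ satisfies $\omega\,\mathrm{Re}(\lambda)+(1-\omega)\,\mathrm{Im}(\lambda)>0$ (it exists and is unique under these hypotheses). Linear convergence is measured by root factor: $\Phi_k\to\Phi$ with $\limsup_{k\to\infty}\|\Phi_k-\Phi\|^{1/k}<1$. *)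

(* Defs.v *)
From HB Require Import structures.
From mathcomp Require Import all_boot all_order all_algebra.
From mathcomp Require Import complex mxtens.
From mathcomp Require Import all_classical all_reals all_analysis.
Set Implicit Arguments.
Unset Strict Implicit.
Unset Printing Implicit Defensive.
Import Order.TTheory GRing.Theory Num.Theory.
Import numFieldNormedType.Exports.
Local Open Scope ring_scope.
Local Open Scope complex_scope.

Definition mx_le (R : realType) (p q : nat) (M N : 'M[R]_(p, q)) : Prop :=
  forall i j, M i j <= N i j.

Definition mx_gt0 (R : realType) (p q : nat) (M : 'M[R]_(p, q)) : Prop :=
  forall i j, 0 < M i j.

Definition nonsing_Mmatrix (R : realType) (p : nat) (M : 'M[R]_p) : Prop :=
  (forall i j, i != j -> M i j <= 0) /\
  exists u : 'cV[R]_p, mx_gt0 u /\ mx_gt0 (M *m u).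

(* In [R[i]] the norm [`|z|] is itself a complex number (with zero imaginary
   part); its real part is the modulus as an element of [R]. *)
Definition absmx (R : realType) (p q : nat) (M : 'M[R[i]]_(p, q)) :
    'M[R]_(p, q) :=
  map_mx (fun z => complex.Re `|z|) M.

Definition omega_part (R : realType) (omega : R) (z : R[i]) : R :=
  omega * complex.Re z + (1 - omega) * complex.Im z.

Definition comparison (R : realType) (omega : R) (p : nat) (M : 'M[R[i]]_p) :
    'M[R]_p :=
  \matrix_(i, j) if i == j then omega_part omega (M i i) else - absmx M i j.

Definition Qmx (K : zmodType) (m n : nat) (A : 'M[K]_m) (B : 'M[K]_(m, n))
    (C : 'M[K]_(n, m)) (D : 'M[K]_n) : 'M[K]_(n + m) :=
  block_mx D (- C) (- B) A.

Definition class_H (R : realType) (omega : R) (m n : nat) (A : 'M[R[i]]_m)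
    (B : 'M[R[i]]_(m, n)) (C : 'M[R[i]]_(n, m)) (D : 'M[R[i]]_n) : Prop :=
  nonsing_Mmatrix (comparison omega (Qmx A B C D)).

Definition is_solution (R : realType) (m n : nat) (A : 'M[R[i]]_m)
    (B : 'M[R[i]]_(m, n)) (C : 'M[R[i]]_(n, m)) (D : 'M[R[i]]_n)
    (X : 'M[R[i]]_(m, n)) : Prop :=
  X *m C *m X - X *m D - A *m X + B = 0.

Definition is_extremal (R : realType) (omega : R) (m n : nat) (A : 'M[R[i]]_m)
    (B : 'M[R[i]]_(m, n)) (C : 'M[R[i]]_(n, m)) (D : 'M[R[i]]_n)
    (X : 'M[R[i]]_(m, n)) : Prop :=
  is_solution A B C D X /\
  forall lambda : R[i],
    eigenvalue (D - C *m X) lambda -> 0 < omega_part omega lambda.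

Definition is_iteration (R : realType) (m n : nat)
    (A1 A2 : 'M[R[i]]_m) (B : 'M[R[i]]_(m, n)) (C : 'M[R[i]]_(n, m))
    (D1 D2 : 'M[R[i]]_n) (Phi_ : nat -> 'M[R[i]]_(m, n)) : Prop :=
  Phi_ 0%N = 0 /\
  forall k, A1 *m Phi_ k.+1 + Phi_ k.+1 *m D1 =
            B + A2 *m Phi_ k + Phi_ k *m D2 + Phi_ k *m C *m Phi_ k.

(* [mx_norm] is the entrywise maximum; taking it on the real matrix of moduli
   keeps it in [R] instead of [R[i]]. *)
Definition max_modulus (R : realType) (m n : nat) (M : 'M[R[i]]_(m, n)) : R :=
  mx_norm (absmx M).

(* The limsup is taken in the extended reals, so no boundedness side condition
   is needed; its value does not depend on the choice of the matrix norm. *)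
Definition linearly_converges (R : realType) (m n : nat)
    (Phi_ : nat -> 'M[R[i]]_(m, n)) (Phi : 'M[R[i]]_(m, n)) : Prop :=
  ((fun k => max_modulus (Phi_ k - Phi)) @ \oo --> (0 : R))%classic /\
  (limn_esup (fun k => (max_modulus (Phi_ k - Phi) `^ (k%:R^-1))%:E) < 1%:E)%E.

(* Main.v *)
From HB Require Import structures.
Require Import Defs.
From mathcomp Require Import all_boot all_order all_algebra.
From mathcomp Require Import complex mxtens.
From mathcomp Require Import all_classical all_reals all_analysis.
From mathcomp Require Import ring lra.
Set Implicit Arguments.
Unset Strict Implicit.
Unset Printing Implicit Defensive.
Import Order.TTheory GRing.Theory Num.Theory.
Import numFieldNormedType.Exports.
Local Open Scope ring_scope.
Local Open Scope complex_scope.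

(** Method of majorants.  Write [L X = A1 X + X D1] and [Lt X = P X + X G] with
    [P], [G] the comparison matrices of [A1], [D1], so that the iteration reads
    [L X_(k+1) = B + A2 X_k + X_k D2 + X_k C X_k].

    Because [omega_part] is additive and bounded by the modulus, [L X = F] implies
    [Lt |X| <= |F|] (lemma [comparison_sylvester]); and [Lt] obeys a maximum
    principle, [Lt X >= 0] implies [X >= 0], since the Kronecker hypothesis
    supplies a positive [U] with [Lt U] positive (lemmas [kronecker_sylvester] and
    [sylvester_max_principle]).  Hence the complex iterates [X_k] are controlled
    by the real iterates [Y_k] started at 0 and built from [Lt], [|A2|], [|B|],
    [|C|], [|D2|]: [|X_k| <= Y_k] and [|X_(k+1) - X_k| <= Y_(k+1) - Y_k] (lemma
    [iteration_majorized]).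

    The majorant [Y_k] increases, and [Qt 1 > 0] keeps its row sums at most 1
    (lemma [majorant_row_sum]), so it converges to a solution [Y] of the real
    equation, and [X_k] converges with it.  With [At = P - |A2|] and
    [Dt = G - |D2|], the equation for [Y] turns [Qt 1 > 0] into
    [(At - Y |C|) (1 - Y 1) > 0] and [(Dt - |C| Y) 1 > 0] (lemmas
    [majorant_dual_vector] and [majorant_primal_vector]).  Let [u = 1 - Y 1] and
    let [v] be a positive row vector with [v (Dt - |C| Y) > 0].  Then the rank-one
    matrix [W = u v] is strictly contracted by the linearization of the real
    iteration at [Y], which gives [Y - Y_k <= r^k W] for some [r < 1]
    (lemma [majorant_geometric]), and the same rate for [X_k].

    The two positive vectors also identify the limit [Phi].  Since [|Phi| <= Y],
    they make [D - C Phi] and [A - Phi C] dominant in the sense of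
    [omega_part], so by Gershgorin's argument the eigenvalues of [D - C Phi] lie
    in the required half-plane.  If [X] is another extremal solution then
    [Z = X - Phi] satisfies [(A - Phi C) Z + Z (D - C X) = 0], where the spectra
    of [D - C X] and [-(A - Phi C)] are separated by that half-plane, so
    [Z = 0] (lemmas [sylvester_spectrum_inj] and [extremal_unique]). *)

(** * The entrywise order on real matrices *)

Section EntrywiseOrder.
Variable R : realType.

Lemma mx_le_refl p q (M : 'M[R]_(p, q)) : mx_le M M.
Proof. by move=> i j. Qed.

Lemma mx_le_trans p q (N M P : 'M[R]_(p, q)) :
  mx_le M N -> mx_le N P -> mx_le M P.
Proof. by move=> MN NP i j; apply: le_trans (MN i j) (NP i j). Qed.

Lemma mx_le_eq p q (M N : 'M[R]_(p, q)) : M = N -> mx_le M N.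
Proof. by move->. Qed.

Lemma mx_leD p q (M N P Q : 'M[R]_(p, q)) :
  mx_le M N -> mx_le P Q -> mx_le (M + P) (N + Q).
Proof. by move=> MN PQ i j; rewrite !mxE lerD. Qed.

Lemma mx_subr_ge0 p q (M N : 'M[R]_(p, q)) : mx_le 0 (N - M) <-> mx_le M N.
Proof.
split=> H i j; first by move: (H i j); rewrite !mxE subr_ge0.
by rewrite !mxE subr_ge0.
Qed.

Lemma mx_leM p q s (M N : 'M[R]_(p, q)) (P Q : 'M[R]_(q, s)) :
  mx_le 0 M -> mx_le M N -> mx_le 0 P -> mx_le P Q ->
  mx_le (M *m P) (N *m Q).
Proof.
move=> M0 MN P0 PQ i j; rewrite !mxE; apply: ler_sum => k _.
by have := M0 i k; have := P0 k j; rewrite !mxE => *; apply: ler_pM.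
Qed.

Lemma mulmx_ge0 p q s (M : 'M[R]_(p, q)) (N : 'M[R]_(q, s)) :
  mx_le 0 M -> mx_le 0 N -> mx_le 0 (M *m N).
Proof.
by move=> M0 N0; rewrite -(mul0mx p N); apply: mx_leM => //; apply: mx_le_refl.
Qed.

Lemma mx_leMr p q s (M N : 'M[R]_(p, q)) (P : 'M[R]_(q, s)) :
  mx_le M N -> mx_le 0 P -> mx_le (M *m P) (N *m P).
Proof.
move=> MN P0; apply/mx_subr_ge0; rewrite -mulmxBl; apply: mulmx_ge0 => //.
exact/mx_subr_ge0.
Qed.

Lemma addmx_ge0 p q (M N : 'M[R]_(p, q)) :
  mx_le 0 M -> mx_le 0 N -> mx_le 0 (M + N).
Proof. by move=> M0 N0; rewrite -(addr0 0); apply: mx_leD. Qed.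

Lemma mx_gt0W p q (M : 'M[R]_(p, q)) : mx_gt0 M -> mx_le 0 M.
Proof. by move=> M0 i j; rewrite mxE ltW. Qed.

Lemma mx_gt0_le p q (M N : 'M[R]_(p, q)) : mx_gt0 M -> mx_le M N -> mx_gt0 N.
Proof. by move=> M0 MN i j; apply: lt_le_trans (M0 i j) (MN i j). Qed.

(** Finitely many strict inequalities leave a common positive margin. *)
Lemma mx_gt0_margin p q (P Q : 'M[R]_(p, q)) :
  mx_gt0 Q -> exists2 d : R, 0 < d < 1 & mx_le (d *: P) Q.
Proof.
move=> Q0.
(* [K] bounds every ratio [|P i j| / Q i j]; the summand 2 keeps [d] below 1. *)
pose K := \sum_ij (`|P ij.1 ij.2| / Q ij.1 ij.2).
have K0 : 0 <= K.
  by apply: sumr_ge0 => ij _; rewrite divr_ge0 // ltW.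
exists (2 + K)^-1; first by rewrite invr_gt0 invf_lt1; lra.
move=> i j; rewrite mxE mulrC ler_pdivrMr; last by lra.
apply: (le_trans (ler_norm _)).
have Qij := Q0 i j.
rewrite mulrC -ler_pdivrMr //.
apply: (@le_trans _ _ K); last by lra.
rewrite /K (bigD1 (i, j)) //= lerDl; apply: sumr_ge0 => ij _.
by rewrite divr_ge0 // ltW.
Qed.

End EntrywiseOrder.

(** * Maximum principle for Z-matrices *)

Section Zmatrices.
Variable R : realType.

Definition Zmatrix p (M : 'M[R]_p) := forall i j, i != j -> M i j <= 0.

Lemma Zmatrix_tr p (M : 'M[R]_p) : Zmatrix M -> Zmatrix M^T.
Proof. by move=> Z i j ij; rewrite mxE Z // eq_sym. Qed.

Lemma Zmatrix_sub p (M N : 'M[R]_p) : Zmatrix M -> mx_le 0 N -> Zmatrix (M - N).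
Proof.
by move=> Z N0 i j ij; have := Z _ _ ij; have := N0 i j; rewrite !mxE; lra.
Qed.

(** At a zero entry of a nonnegative [V], only the nonpositive off-diagonal
    entries of [M] contribute. *)
Lemma Zmatrix_mul_at_zero p q (M : 'M[R]_p) (V : 'M[R]_(p, q)) i j :
  Zmatrix M -> mx_le 0 V -> V i j = 0 -> (M *m V) i j <= 0.
Proof.
move=> Z V0 Vij; rewrite mxE; apply: sumr_le0 => k _.
have [<-|ik] := eqVneq i k; first by rewrite Vij mulr0.
by apply: mulr_le0_ge0; [apply: Z|have := V0 k j; rewrite mxE].
Qed.

Lemma mul_Zmatrix_at_zero p q (M : 'M[R]_q) (V : 'M[R]_(p, q)) i j :
  Zmatrix M -> mx_le 0 V -> V i j = 0 -> (V *m M) i j <= 0.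
Proof.
move=> Z V0 Vij; rewrite -[V *m M]trmxK mxE trmx_mul.
apply: Zmatrix_mul_at_zero; first exact: Zmatrix_tr.
  by move=> k l; have := V0 l k; rewrite !mxE.
by rewrite mxE.
Qed.

(** Subtract from [X] the multiple [t *: U] that touches it from below: at the
    contact entry the off-diagonal terms are nonpositive, so a negative [t] would
    make the image of [X] negative there. *)
Lemma sylvester_max_principle p q (P : 'M[R]_p) (G : 'M[R]_q)
    (U X : 'M[R]_(p, q)) :
  Zmatrix P -> Zmatrix G -> mx_gt0 U -> mx_gt0 (P *m U + U *m G) ->
  mx_le 0 (P *m X + X *m G) -> mx_le 0 X.
Proof.
move=> ZP ZG U0 LU0 LX0 i0 j0; rewrite mxE leNgt; apply/negP => Xlt0.
have [[i j] _ /= tmin] := @Order.TotalTheory.arg_minP _ _ _ (i0, j0) xpredT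
  (fun ij => X ij.1 ij.2 / U ij.1 ij.2) isT.
set t := X i j / U i j in tmin.
have t_lt0 : t < 0.
  apply: (le_lt_trans (tmin (i0, j0) isT)) => /=.
  by rewrite pmulr_llt0 // invr_gt0.
pose V := X - t *: U.
have V0 : mx_le 0 V.
  move=> k l; rewrite !mxE subr_ge0 -ler_pdivlMr //.
  exact: (tmin (k, l) isT).
have Vij : V i j = 0.
  by rewrite !mxE /t mulfVK ?subrr // gt_eqF.
have XV : X = V + t *: U by rewrite /V subrK.
have LXE : P *m X + X *m G = (P *m V + V *m G) + t *: (P *m U + U *m G).
  by rewrite XV mulmxDr mulmxDl -scalemxAr -scalemxAl scalerDr addrACA.
have := LX0 i j; rewrite LXE mxE [X in _ <= X]mxE leNgt => /negP; apply.
have h1 := Zmatrix_mul_at_zero ZP V0 Vij.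
have h2 := mul_Zmatrix_at_zero ZG V0 Vij.
have h3 : t * (P *m U + U *m G) i j < 0 by rewrite nmulr_rlt0.
rewrite [X in X + _ < _]mxE [X in _ + X < _]mxE.
by rewrite -(addr0 0) ler_ltD // -(addr0 0) lerD.
Qed.

Lemma sylvester_le p q (P : 'M[R]_p) (G : 'M[R]_q) (U X Y : 'M[R]_(p, q)) :
  Zmatrix P -> Zmatrix G -> mx_gt0 U -> mx_gt0 (P *m U + U *m G) ->
  mx_le (P *m X + X *m G) (P *m Y + Y *m G) -> mx_le X Y.
Proof.
move=> ZP ZG U0 LU0 LXY; apply/mx_subr_ge0.
apply: sylvester_max_principle ZP ZG U0 LU0 _.
rewrite mulmxBr mulmxBl addrACA -opprD; exact/mx_subr_ge0.
Qed.

Lemma sylvester_inj p q (P : 'M[R]_p) (G : 'M[R]_q) (U X : 'M[R]_(p, q)) :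
  Zmatrix P -> Zmatrix G -> mx_gt0 U -> mx_gt0 (P *m U + U *m G) ->
  P *m X + X *m G = 0 -> X = 0.
Proof.
move=> ZP ZG U0 LU0 LX0.
have le V W : P *m V + V *m G = P *m W + W *m G -> mx_le V W.
  by move=> LVW; apply: (sylvester_le ZP ZG U0 LU0); rewrite LVW.
have L0 : P *m 0 + 0 *m G = 0 :> 'M[R]_(p, q).
  by rewrite mulmx0 mul0mx addr0.
apply/matrixP => i j; apply: le_anti.
by rewrite (le X 0 _ i j) ?(le 0 X _ i j) // L0.
Qed.

(** The case of a trivial right factor: Z-matrices with a positive vector
    mapped to a positive vector are monotone. *)
Lemma Mmatrix_max_principle p q (P : 'M[R]_p) (u : 'cV[R]_p) (X : 'M[R]_(p, q)) :
  Zmatrix P -> mx_gt0 u -> mx_gt0 (P *m u) -> mx_le 0 (P *m X) -> mx_le 0 X.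
Proof.
move=> ZP u0 Pu0 PX0 i j.
apply: (@sylvester_max_principle p q P 0 (u *m const_mx 1)) => //.
- by move=> k l _; rewrite mxE.
- by move=> k l; rewrite mxE big_ord1 [const_mx _ _ _]mxE mulr1.
- rewrite mulmx0 addr0 mulmxA => k l.
  by rewrite mxE big_ord1 [const_mx _ _ _]mxE mulr1.
- by rewrite mulmx0 addr0.
Qed.

Lemma inj_unitmx (K : fieldType) p (M : 'M[K]_p) :
  (forall X : 'M[K]_p, M *m X = 0 -> X = 0) -> M \in unitmx.
Proof.
move=> inj; rewrite -unitmx_tr -row_free_unit -kermx_eq0 -trmx_eq0.
by apply/eqP/inj; rewrite -[LHS]trmxK trmx_mul trmxK mulmx_ker trmx0.
Qed.

(** The row vector is [1^T G^-1]: by monotonicity [G^-1 >= 0], and a zero entry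
    of it would force a nonpositive entry of [1^T]. *)
Lemma Mmatrix_left_vector p (G : 'M[R]_p) (u : 'cV[R]_p) :
  Zmatrix G -> mx_gt0 u -> mx_gt0 (G *m u) ->
  exists v : 'rV[R]_p, mx_gt0 v /\ mx_gt0 (v *m G).
Proof.
move=> ZG u0 Gu0.
have Gunit : G \in unitmx.
  apply: inj_unitmx => X GX0.
  have ge0 (V : 'M[R]_p) : G *m V = 0 -> mx_le 0 V.
    move=> GV0; apply: (Mmatrix_max_principle ZG u0 Gu0); rewrite GV0.
    exact: mx_le_refl.
  apply/matrixP => i j; rewrite [RHS]mxE; apply: le_anti.
  have := ge0 (- X); rewrite mulmxN GX0 oppr0 => /(_ erefl i j).
  by have := ge0 X GX0 i j; rewrite !mxE oppr_ge0 => -> ->.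
have Ginv0 : mx_le 0 (invmx G).
  apply: (Mmatrix_max_principle ZG u0 Gu0); rewrite mulmxV //.
  by move=> i j; rewrite !mxE ler0n.
pose v : 'rV[R]_p := const_mx 1 *m invmx G.
have vG : v *m G = const_mx 1 by rewrite -mulmxA mulVmx // mulmx1.
have v0 : mx_le 0 v by apply: mulmx_ge0 => // i j; rewrite !mxE.
have vG0 : mx_gt0 (v *m G) by move=> i j; rewrite vG mxE.
exists v; split=> // i j; rewrite lt_neqAle eq_sym.
have := v0 i j; rewrite mxE => ->; rewrite andbT; apply/negP => /eqP vij.
by have := mul_Zmatrix_at_zero ZG v0 vij; rewrite leNgt vG0.
Qed.

End Zmatrices.

(** * Moduli and comparison matrices *)

Section Moduli.
Variable R : realType.
Implicit Types (z : R[i]).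

Notation modulus z := (complex.Re `|z|).

Lemma modulusC z : (modulus z)%:C = `|z|.
Proof. by rewrite normc_def. Qed.

Lemma modulus_ge0 z : 0 <= modulus z.
Proof. by rewrite -ler0c modulusC normr_ge0. Qed.

Lemma modulusD z1 z2 : modulus (z1 + z2) <= modulus z1 + modulus z2.
Proof. by rewrite -lecR rmorphD /= !modulusC ler_normD. Qed.

Lemma modulusM z1 z2 : modulus (z1 * z2) = modulus z1 * modulus z2.
Proof. by apply: complexI; rewrite rmorphM /= !modulusC normrM. Qed.

Lemma modulus_sum (I : Type) (r : seq I) (P : pred I) (F : I -> R[i]) :
  modulus (\sum_(k <- r | P k) F k) <= \sum_(k <- r | P k) modulus (F k).
Proof.
apply: (big_rec2 (fun x y => modulus x <= y)) => [|k y x _ IH].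
  by rewrite normr0.
by apply: le_trans (modulusD _ _) _; rewrite lerD2l.
Qed.

Lemma modulus_eq0 z : modulus z <= 0 -> z = 0.
Proof.
move=> z0; apply/normr0_eq0; rewrite -modulusC; apply/eqP.
by rewrite eq_le ler0c modulus_ge0 -[X in _ <= X]/(0%:C) lecR z0.
Qed.

Lemma Re_le_modulus z : `|complex.Re z| <= modulus z.
Proof. by rewrite -lecR modulusC normc_ge_Re. Qed.

Lemma Im_le_modulus z : `|complex.Im z| <= modulus z.
Proof.
by rewrite normc_def /= -sqrtr_sqr ler_wsqrtr // lerDr sqr_ge0.
Qed.

Lemma modulus_le_ReIm z : modulus z <= `|complex.Re z| + `|complex.Im z|.
Proof.
rewrite normc_def /= -[leRHS]ger0_norm ?addr_ge0 // -sqrtr_sqr ler_wsqrtr //.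
rewrite sqrrD !real_normK ?num_real // addrAC lerDl.
by rewrite mulrn_wge0 // mulr_ge0.
Qed.

Lemma absmx_ge0 p q (M : 'M[R[i]]_(p, q)) : mx_le 0 (absmx M).
Proof. by move=> i j; rewrite !mxE modulus_ge0. Qed.

Lemma absmx_eq0 p q (M : 'M[R[i]]_(p, q)) : mx_le (absmx M) 0 -> M = 0.
Proof.
by move=> M0; apply/matrixP => i j; have := M0 i j; rewrite !mxE => /modulus_eq0.
Qed.

Lemma absmx0 p q : absmx (0 : 'M[R[i]]_(p, q)) = 0.
Proof. by apply/matrixP => i j; rewrite !mxE normr0. Qed.

Lemma absmxN p q (M : 'M[R[i]]_(p, q)) : absmx (- M) = absmx M.
Proof. by apply/matrixP => i j; rewrite !mxE normrN. Qed.

Lemma absmxD p q (M N : 'M[R[i]]_(p, q)) :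
  mx_le (absmx (M + N)) (absmx M + absmx N).
Proof. by move=> i j; rewrite !mxE modulusD. Qed.

Lemma absmxB p q (M N : 'M[R[i]]_(p, q)) :
  mx_le (absmx (M - N)) (absmx M + absmx N).
Proof. by rewrite -(absmxN N); apply: absmxD. Qed.

Lemma absmxM p q s (M : 'M[R[i]]_(p, q)) (N : 'M[R[i]]_(q, s)) :
  mx_le (absmx (M *m N)) (absmx M *m absmx N).
Proof.
move=> i j; rewrite !mxE; apply: le_trans (modulus_sum _ _ _) _.
by apply: ler_sum => k _; rewrite !mxE modulusM.
Qed.

Variable omega : R.
Hypothesis omega01 : 0 <= omega <= 1.

Lemma omega_partD z1 z2 :
  omega_part omega (z1 + z2) = omega_part omega z1 + omega_part omega z2.
Proof. by case: z1 z2 => a b [c d]; rewrite /omega_part /=; ring. Qed.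

Lemma omega_partN z : omega_part omega (- z) = - omega_part omega z.
Proof. by case: z => a b; rewrite /omega_part /=; ring. Qed.

Lemma omega_part_le_modulus z : omega_part omega z <= modulus z.
Proof.
have := Re_le_modulus z; have := Im_le_modulus z; rewrite /omega_part.
have := ler_norm (complex.Re z); have := ler_norm (complex.Im z).
case/andP: omega01 => *; nra.
Qed.

Lemma comparison_Zmatrix p (M : 'M[R[i]]_p) : Zmatrix (comparison omega M).
Proof.
by move=> i j /negPf ij; rewrite !mxE ij oppr_le0 modulus_ge0.
Qed.

Lemma comparison_sub p (M N : 'M[R[i]]_p) :
  mx_le (comparison omega M - absmx N) (comparison omega (M - N)).
Proof.
move=> i j; rewrite !mxE; case: eqP => [<-|_].
  by rewrite omega_partD omega_partN lerD2l lerN2 omega_part_le_modulus.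
by rewrite -opprD lerN2 -(normrN (N i j)) modulusD.
Qed.

(** Gershgorin's estimate for the Sylvester operator: its diagonal coefficient
    at [(i, j)] is [A i i + D j j], of modulus at least
    [omega_part (A i i) + omega_part (D j j)] because the functional
    [omega_part] is additive and bounded by the modulus. *)
Lemma comparison_sylvester p q (A : 'M[R[i]]_p) (D : 'M[R[i]]_q)
    (X : 'M[R[i]]_(p, q)) :
  mx_le (comparison omega A *m absmx X + absmx X *m comparison omega D)
        (absmx (A *m X + X *m D)).
Proof.
move=> i j; rewrite 4!mxE [X in _ <= modulus X]mxE.
rewrite [(A *m X) i j]mxE [(X *m D) i j]mxE.
rewrite (bigD1 i) //= [X in _ + X <= _](bigD1 j) //=.
rewrite [\sum_k A i k * _](bigD1 i) //= [\sum_k X i k * _](bigD1 j) //=.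
set SA := \sum_(k | k != i) A i k * X k j.
set SD := \sum_(k | k != j) X i k * D k j.
set TA := \sum_(k | k != i) _; set TD := \sum_(k | k != j) _.
have TAE : TA <= - modulus SA.
  rewrite lerNr; apply: le_trans (modulus_sum _ _ _) _.
  rewrite /TA -sumrN; apply: ler_sum => k /negPf ki.
  by rewrite !mxE eq_sym ki mulNr opprK modulusM.
have TDE : TD <= - modulus SD.
  rewrite lerNr; apply: le_trans (modulus_sum _ _ _) _.
  rewrite /TD -sumrN; apply: ler_sum => k /negPf kj.
  by rewrite !mxE kj mulrN opprK modulusM.
rewrite !mxE !eqxx.
set z := A i i * X i j + SA + _.
rewrite -[X in _ <= X]/(modulus z).
have zE : (A i i + D j j) * X i j = z + (- SA) + (- SD) by rewrite /z; ring.
have := modulusD (z + (- SA)) (- SD); have := modulusD z (- SA).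
rewrite -zE modulusM !normrN.
have := omega_part_le_modulus (A i i + D j j); rewrite omega_partD.
have := modulus_ge0 (X i j) => X0 ell ltA ltD.
have := ler_wpM2r X0 ell; rewrite mulrDl; lra.
Qed.

Lemma comparison_mul p q (M : 'M[R[i]]_p) (X : 'M[R[i]]_(p, q)) :
  mx_le (comparison omega M *m absmx X) (absmx (M *m X)).
Proof.
have := comparison_sylvester M 0 X; rewrite mulmx0 addr0.
suff -> : comparison omega (0 : 'M[R[i]]_q) = 0 by rewrite mulmx0 addr0.
apply/matrixP => i j; rewrite !mxE normr0 oppr0 /omega_part /=.
by rewrite !mulr0 addr0; case: eqP.
Qed.

Lemma comparison_inj p q (M : 'M[R[i]]_p) (u : 'cV[R]_p) (X : 'M[R[i]]_(p, q)) :
  mx_gt0 u -> mx_gt0 (comparison omega M *m u) -> M *m X = 0 -> X = 0.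
Proof.
move=> u0 Mu0 MX0; apply: absmx_eq0; apply/mx_subr_ge0; rewrite sub0r.
apply: (Mmatrix_max_principle (comparison_Zmatrix M) u0 Mu0).
rewrite mulmxN -sub0r; apply/mx_subr_ge0.
by rewrite -(absmx0 p q) -MX0; apply: comparison_mul.
Qed.

(** Shifting by [lambda%:M] raises the diagonal of the comparison matrix by
    [omega_part lambda], so a nonnegative shift keeps the dominance. *)
Lemma comparison_shift_inj p q (M : 'M[R[i]]_p) (u : 'cV[R]_p)
    (lambda : R[i]) (X : 'M[R[i]]_(p, q)) :
  mx_gt0 u -> mx_gt0 (comparison omega M *m u) ->
  0 <= omega_part omega lambda -> (M + lambda%:M) *m X = 0 -> X = 0.
Proof.
move=> u0 Mu0 l0; apply: (comparison_inj u0).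
apply: (mx_gt0_le Mu0); apply: mx_leMr (mx_gt0W u0) => i j.
rewrite !mxE; case: eqP => _; last by rewrite mulr0n addr0.
by rewrite eqxx mulr1n omega_partD lerDl.
Qed.

End Moduli.

Section SylvesterInverse.

Lemma sylvester_inverse (K : fieldType) p q (P : 'M[K]_p) (G : 'M[K]_q) :
  (forall X : 'M[K]_(p, q), P *m X + X *m G = 0 -> X = 0) ->
  exists S : 'M[K]_(p, q) -> 'M[K]_(p, q),
    forall F, P *m S F + S F *m G = F.
Proof.
move=> inj.
pose f (X : 'M[K]_(p, q)) := P *m X + X *m G.
have lin_f : linear f.
  move=> a X Y; rewrite /f mulmxDr mulmxDl -scalemxAr -scalemxAl.
  by rewrite addrACA scalerDr.
pose fM := GRing.isLinear.Build _ _ _ _ f lin_f.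
pose fL : {linear _ -> _} := HB.pack f fM.
have ker0 : lker (linfun fL) == 0%VS.
  apply/lker0P => X Y; rewrite !lfunE /= => eqf.
  apply/eqP; rewrite -subr_eq0; apply/eqP; apply: inj.
  by rewrite mulmxBr mulmxBl addrACA -opprD; apply/eqP; rewrite subr_eq0; apply/eqP.
exists (linfun fL)^-1%VF => F.
by have := lker0_lfunVK ker0 F; rewrite lfunE.
Qed.

End SylvesterInverse.

(** * Limits *)

Section EntrywiseLimits.
Variable R : realType.
Local Open Scope classical_set_scope.

Definition mx_cvg p q (u : nat -> 'M[R]_(p, q)) (l : 'M[R]_(p, q)) :=
  forall i j, u k i j @[k --> \oo] --> l i j.

Lemma mx_cvg_cst p q (M : 'M[R]_(p, q)) : mx_cvg (fun=> M) M.
Proof. by move=> i j; apply: cvg_cst. Qed.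

Lemma mx_cvgD p q (u v : nat -> 'M[R]_(p, q)) a b :
  mx_cvg u a -> mx_cvg v b -> mx_cvg (fun k => u k + v k) (a + b).
Proof.
move=> ua vb i j; rewrite mxE.
rewrite (_ : (fun k => _) = (fun k => u k i j) \+ (fun k => v k i j)).
  exact: cvgD.
by apply/funext => k; rewrite mxE.
Qed.

Lemma mx_cvgM p q s (u : nat -> 'M[R]_(p, q)) (v : nat -> 'M[R]_(q, s)) a b :
  mx_cvg u a -> mx_cvg v b -> mx_cvg (fun k => u k *m v k) (a *m b).
Proof.
move=> ua vb i j; rewrite mxE.
rewrite (_ : (fun k => _) = (fun k => \sum_t u k i t * v k t j)).
  by apply: cvg_big => [|t _]; [exact: add_continuous|exact: cvgM].
by apply/funext => k; rewrite mxE.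
Qed.

Lemma mx_cvg_unique p q (u : nat -> 'M[R]_(p, q)) a b :
  mx_cvg u a -> mx_cvg u b -> a = b.
Proof.
move=> ua ub; apply/matrixP => i j.
exact: (cvg_unique (@Rhausdorff R) (ua i j) (ub i j)).
Qed.

Lemma mx_cvg_shift p q (u : nat -> 'M[R]_(p, q)) a :
  mx_cvg u a -> mx_cvg (fun k => u k.+1) a.
Proof. by move=> ua i j; have := ua i j; rewrite -cvg_shiftS. Qed.

Lemma mx_cvg_le p q (u : nat -> 'M[R]_(p, q)) a M :
  mx_cvg u a -> (forall k, mx_le (u k) M) -> mx_le a M.
Proof.
move=> ua uM i j; apply: (cvgr_to_le (ua i j)).
by apply: nearW => k; exact: uM.
Qed.

Lemma mx_monotone_cvg p q (u : nat -> 'M[R]_(p, q)) M :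
  (forall k, mx_le (u k) (u k.+1)) -> (forall k, mx_le (u k) M) ->
  exists2 a, mx_cvg u a & forall k, mx_le (u k) a.
Proof.
move=> incr bound.
have homo i j : {homo (fun k => u k i j) : k l / (k <= l)%N >-> k <= l}.
  by apply/nondecreasing_seqP => k; exact: incr.
have cvu i j : cvgn (fun k => u k i j).
  apply: nondecreasing_is_cvgn => //.
  by exists (M i j) => _ [k _ <-]; exact: bound.
exists (\matrix_(i, j) limn (fun k => u k i j)) => [i j|k i j]; rewrite mxE.
  exact: cvu.
exact: nondecreasing_cvgn_le (homo i j) (cvu i j) k.
Qed.

(** Both [y + x] and [y - x] are nondecreasing. *)
Lemma majorized_cvg_real (x y : nat -> R) (b : R) :
  (forall k, `|x k.+1 - x k| <= y k.+1 - y k) -> y k @[k --> \oo] --> b ->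
  exists a, forall k, `|a - x k| <= b - y k.
Proof.
move=> xy yb.
pose s k := y k + x k; pose t k := y k - x k.
have incr_s : {homo s : k l / (k <= l)%N >-> k <= l}.
  apply/nondecreasing_seqP => k; have := xy k; rewrite ler_norml /s.
  by case/andP; lra.
have incr_t : {homo t : k l / (k <= l)%N >-> k <= l}.
  apply/nondecreasing_seqP => k; have := xy k; rewrite ler_norml /t.
  by case/andP; lra.
have incr_y : {homo y : k l / (k <= l)%N >-> k <= l}.
  apply/nondecreasing_seqP => k; have := le_trans (normr_ge0 _) (xy k).
  by rewrite subr_ge0.
have y_le k : y k <= b.
  rewrite -(cvg_lim (@Rhausdorff R) yb); apply: nondecreasing_cvgn_le => //.
  by apply/cvg_ex; exists b.
have cvs : cvgn s.
  apply: nondecreasing_is_cvgn => //; exists (2 * b - t 0%N) => _ [k _ <-].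
  have := incr_t _ _ (leq0n k); have := y_le k; rewrite /s /t; lra.
pose a := limn s - b.
have cvt : t k @[k --> \oo] --> b - a.
  rewrite (_ : t = (fun k => y k + y k - s k)); last first.
    by apply/funext => k; rewrite /t /s; ring.
  rewrite (_ : b - a = b + b - limn s); last by rewrite /a; ring.
  by apply: cvgB cvs; exact: cvgD.
exists a => k; rewrite ler_norml.
have := nondecreasing_cvgn_le incr_s cvs k.
have : t k <= b - a.
  rewrite -(cvg_lim (@Rhausdorff R) cvt); apply: nondecreasing_cvgn_le => //.
  by apply/cvg_ex; exists (b - a).
by rewrite /t /a /s => h1 h2; apply/andP; split; lra.
Qed.

(** The real and imaginary parts converge separately, whence the factor 2. *)
Lemma majorized_cvg p q (X_ : nat -> 'M[R[i]]_(p, q)) (Y_ : nat -> 'M[R]_(p, q)) Y :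
  (forall k, mx_le (absmx (X_ k.+1 - X_ k)) (Y_ k.+1 - Y_ k)) -> mx_cvg Y_ Y ->
  exists X, forall k, mx_le (absmx (X - X_ k)) ((Y - Y_ k) + (Y - Y_ k)).
Proof.
move=> XY YY.
have limit_of (f : R[i] -> R) : (forall z w, f (z - w) = f z - f w) ->
    (forall z, `|f z| <= complex.Re `|z|) ->
    exists x : 'I_p * 'I_q -> R,
      forall ij k, `|x ij - f (X_ k ij.1 ij.2)| <= Y ij.1 ij.2 - Y_ k ij.1 ij.2.
  move=> fB fle.
  suff /choice[x xP] : forall ij : 'I_p * 'I_q, exists x, forall k,
      `|x - f (X_ k ij.1 ij.2)| <= Y ij.1 ij.2 - Y_ k ij.1 ij.2 by exists x.
  move=> [i j] /=.
  apply: majorized_cvg_real (YY i j) => k /=; rewrite -fB.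
  by apply: le_trans (fle _) _; have := XY k i j; rewrite !mxE.
have [||x xP] := limit_of (@complex.Re R); first by move=> [? ?] [].
  exact: Re_le_modulus.
have [||y yP] := limit_of (@complex.Im R); first by move=> [? ?] [].
  exact: Im_le_modulus.
exists (\matrix_(i, j) (x (i, j) +i* y (i, j))) => k i j; rewrite !mxE.
apply: le_trans (modulus_le_ReIm _) _.
have := yP (i, j) k; have := xP (i, j) k => /=.
by case: (X_ k i j) => a b /=; exact: lerD.
Qed.

End EntrywiseLimits.

Section RootConvergence.
Variable R : realType.
Local Open Scope classical_set_scope.

Lemma geometric_cvg0 (e : nat -> R) c r :
  0 < r < 1 -> (forall k, 0 <= e k <= c * r ^+ k) -> e k @[k --> \oo] --> 0.
Proof.
move=> /andP[r0 r1] ebound.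
apply: (@squeeze_cvgr _ _ _ _ (fun=> 0) (fun k => c * r ^+ k)).
- by apply: nearW => k; exact: ebound.
- exact: cvg_cst.
- by apply: cvg_geometric; rewrite ger0_norm // ltW.
Qed.

(** For [r < s < 1] the constant is absorbed: [c r^k <= s^k] for large [k]. *)
Lemma geometric_root_lt1 (e : nat -> R) c r :
  0 < r < 1 -> (forall k, 0 <= e k <= c * r ^+ k) ->
  (limn_esup (fun k => (e k `^ (k%:R^-1))%:E) < 1%:E)%E.
Proof.
move=> /andP[r0 r1] ebound.
pose s := (r + 1) / 2.
have rs : r < s by rewrite /s; lra.
have s1 : s < 1 by rewrite /s; lra.
have s0 : 0 < s by lra.
have q0 : 0 < r / s by rewrite divr_gt0.
have q1 : `|r / s| < 1 by rewrite (gtr0_norm q0) ltr_pdivrMr // mul1r.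
have eventually_small : \forall k \near \oo, (0 < k)%N /\ c * r ^+ k <= s ^+ k.
  near=> k; split; first by near: k; exact: nbhs_infty_gt.
  have : c * (r / s) ^+ k <= 1.
    near: k; apply: (@cvgr_le _ _ _ _ (fun k => c * (r / s) ^+ k) 0) => //.
    exact: cvg_geometric.
  by rewrite expr_div_n mulrA ler_pdivrMr ?exprn_gt0 // mul1r.
apply: (@le_lt_trans _ _ s%:E); last by rewrite lte_fin.
apply: ge_ereal_inf.
exists (ereal_sup [set (e k `^ (k%:R^-1))%:E | k in
  [set k | (0 < k)%N /\ c * r ^+ k <= s ^+ k]]).
  by exists [set k | (0 < k)%N /\ c * r ^+ k <= s ^+ k].
apply: ge_ereal_sup => _ [k [k0 ck] <-]; rewrite lee_fin.
have /andP[ek0 ekc] := ebound k.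
have sE : s = (s ^+ k) `^ (k%:R^-1).
  rewrite -powR_mulrn ?ltW // -powRrM divff ?powRr1 ?ltW //.
  by rewrite pnatr_eq0 -lt0n.
rewrite [leRHS]sE; apply: ge0_ler_powR; last exact: le_trans ekc ck.
- by rewrite invr_ge0 ler0n.
- by rewrite nnegrE.
- by rewrite nnegrE exprn_ge0 // ltW.
Unshelve. all: by end_near.
Qed.

Lemma geometric_linearly_converges m n (X_ : nat -> 'M[R[i]]_(m, n)) X
    (W : 'M[R]_(m, n)) r :
  0 < r < 1 -> (forall k, mx_le (absmx (X - X_ k)) (r ^+ k *: W)) ->
  linearly_converges X_ X.
Proof.
move=> r01 XW; have /andP[r0 r1] := r01.
have bound k : 0 <= max_modulus (X_ k - X) <= mx_norm W * r ^+ k.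
  have normW0 : 0 <= mx_norm W by rewrite mx_normrE; exact: bigmax_ge_id.
  rewrite /max_modulus [mx_norm (absmx _)]mx_normrE; apply/andP; split.
    exact: bigmax_ge_id.
  apply: bigmax_le => [|[i j] _ /=].
    by rewrite mulr_ge0 // exprn_ge0 // ltW.
  have := XW k i j; rewrite !mxE distrC (ger0_norm (modulus_ge0 _)) => /le_trans.
  apply; rewrite mulrC ler_pM2r ?exprn_gt0 //; apply: le_trans (ler_norm _) _.
  rewrite mx_normrE.
  exact: (@le_bigmax _ _ _ 0 (fun ij : 'I_m * 'I_n => `|W ij.1 ij.2|) (i, j)).
split; first exact: geometric_cvg0 r01 bound.
exact: geometric_root_lt1 r01 bound.
Qed.

End RootConvergence.

(** * The quadratic right-hand side and its real majorant *)

(** [set] identifies products typed through different canonical structures, which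
    [generalize] would keep apart. *)
Ltac generalize_products :=
  repeat match goal with |- context [@mulmx ?K ?p ?q ?s ?M ?N] =>
    let P := fresh "P" in set P := (@mulmx K p q s M N); clearbody P
  end.

(** Closes identities of sums of matrix products, products being atoms. *)
Ltac mx_abelian :=
  apply/matrixP => ? ?; generalize_products; rewrite !mxE; ring.

Section RiccatiRhs.
Variables (K : comNzRingType) (m n : nat).
Variables (A2 : 'M[K]_m) (B : 'M[K]_(m, n)) (C : 'M[K]_(n, m)) (D2 : 'M[K]_n).

Definition riccati_rhs (X : 'M[K]_(m, n)) :=
  B + A2 *m X + X *m D2 + X *m C *m X.

(** The exact difference of two values of [riccati_rhs], as a function of the
    difference [E] of the arguments; for [X = Y] it is the derivative at [X]. *)
Definition riccati_increment (X Y E : 'M[K]_(m, n)) :=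
  A2 *m E + E *m D2 + (E *m C *m X + Y *m C *m E).

Lemma riccati_rhsB X Y :
  riccati_rhs X - riccati_rhs Y = riccati_increment X Y (X - Y).
Proof.
rewrite /riccati_rhs /riccati_increment !(mulmxBl, mulmxBr); mx_abelian.
Qed.

End RiccatiRhs.

Section Majorant.
Variables (R : realType) (m n : nat).
Variables (P A2 : 'M[R]_m) (B : 'M[R]_(m, n)) (C : 'M[R]_(n, m)) (G D2 : 'M[R]_n).
Variable (U : 'M[R]_(m, n)).
Hypothesis ZP : Zmatrix P.
Hypothesis ZG : Zmatrix G.
Hypothesis A20 : mx_le 0 A2.
Hypothesis B0 : mx_le 0 B.
Hypothesis C0 : mx_le 0 C.
Hypothesis D20 : mx_le 0 D2.
Hypothesis U0 : mx_gt0 U.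
Hypothesis LU0 : mx_gt0 (P *m U + U *m G).

Local Notation one p := (const_mx 1 : 'cV[R]_p).
Local Notation At := (P - A2).
Local Notation Dt := (G - D2).
Local Notation rhs := (riccati_rhs A2 B C D2).

Hypothesis hA : mx_gt0 (At *m one m - B *m one n).
Hypothesis hD : mx_gt0 (Dt *m one n - C *m one m).

Variable Y_ : nat -> 'M[R]_(m, n).
Hypothesis Y0 : Y_ 0%N = 0.
Hypothesis YS : forall k, P *m Y_ k.+1 + Y_ k.+1 *m G = rhs (Y_ k).

Lemma one_gt0 p : mx_gt0 (one p).
Proof. by move=> i j; rewrite mxE. Qed.

Lemma riccati_increment_le X X' Y Y' E E' :
  mx_le 0 X -> mx_le X X' -> mx_le 0 Y -> mx_le Y Y' ->
  mx_le 0 E -> mx_le E E' ->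
  mx_le (riccati_increment A2 C D2 X Y E) (riccati_increment A2 C D2 X' Y' E').
Proof.
move=> X0 XX' Y0' YY' E0 EE'.
do 2?apply: mx_leD; rewrite -?mulmxA; do ?apply: mx_leM => //; exact: mulmx_ge0.
Qed.

Lemma riccati_rhs_le X Y :
  mx_le 0 X -> mx_le X Y -> mx_le (rhs X) (rhs Y).
Proof.
move=> X0 XY; apply/mx_subr_ge0; rewrite riccati_rhsB.
have E0 : mx_le 0 (Y - X) by apply/mx_subr_ge0.
have Y0' := mx_le_trans X0 XY.
by do 3?apply: addmx_ge0; do ?apply: mulmx_ge0.
Qed.

Lemma majorant_le X Y :
  mx_le (P *m X + X *m G) (P *m Y + Y *m G) -> mx_le X Y.
Proof. exact: sylvester_le ZP ZG U0 LU0. Qed.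

Lemma majorant_monotone k : mx_le 0 (Y_ k) /\ mx_le (Y_ k) (Y_ k.+1).
Proof.
elim: k => [|k [Yk0 YkS]].
  rewrite Y0; split; first exact: mx_le_refl.
  apply: majorant_le; rewrite YS Y0 mulmx0 mul0mx addr0 /riccati_rhs.
  by rewrite !(mulmx0, mul0mx) !addr0.
split; first exact: mx_le_trans YkS.
by apply: majorant_le; rewrite !YS; apply: riccati_rhs_le.
Qed.

(** The row sums of [P *m Y_ k.+1] are at most those of [B + A2]: by
    monotonicity [Y_ k.+1] times the positive slack of the [D]-rows absorbs the
    terms of the right-hand side that involve [D2] and [C]. *)
Lemma majorant_row_sum k : mx_le (Y_ k *m one n) (one m).
Proof.
elim: k => [|k IH]; first by rewrite Y0 mul0mx; apply/mx_gt0W/one_gt0.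
have [Yk0 YkS] := majorant_monotone k.
have [YS0 _] := majorant_monotone k.+1.
set Y := Y_ k in IH Yk0 YkS *; set Y' := Y_ k.+1 in YkS YS0 *.
have one0 p : mx_le 0 (one p) := mx_gt0W (@one_gt0 p).
have P1 : mx_gt0 (P *m one m).
  apply: (mx_gt0_le hA); apply/mx_subr_ge0.
  rewrite (_ : _ - _ = A2 *m one m + B *m one n).
    by apply: addmx_ge0; apply: mulmx_ge0.
  by rewrite mulmxBl; mx_abelian.
apply/mx_subr_ge0; apply: (Mmatrix_max_principle ZP (@one_gt0 m) P1).
have bound : mx_le (rhs Y *m one n)
    (B *m one n + A2 *m one m + Y' *m D2 *m one n + Y' *m C *m one m).
  rewrite /riccati_rhs !mulmxDl -!mulmxA.
  do 3?apply: mx_leD => //.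
  - by apply: mx_leM => //; apply: mulmx_ge0.
  - by apply: mx_leM => //; apply: mulmx_ge0.
  - apply: mx_leM => //; do ?apply: mulmx_ge0 => //.
    by apply: mx_leM => //; apply: mulmx_ge0.
apply: (mx_le_trans (mx_gt0W hA)).
have slack := mulmx_ge0 YS0 (mx_gt0W hD).
move: bound; rewrite -YS -/Y' => /mx_subr_ge0 bound.
apply/mx_subr_ge0; apply: mx_le_trans (addmx_ge0 bound slack) _.
apply: mx_le_eq; rewrite !(mulmxBr, mulmxBl, mulmxDl) !mulmxA; mx_abelian.
Qed.

Lemma majorant_limit : exists Y, [/\ mx_cvg Y_ Y, forall k, mx_le (Y_ k) Y,
  P *m Y + Y *m G = rhs Y & mx_le (Y *m one n) (one m)].
Proof.
have bound k : mx_le (Y_ k) (const_mx 1).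
  move=> i j; have := majorant_row_sum k i 0; rewrite !mxE; apply: le_trans.
  rewrite (bigD1 j) //= mxE mulr1 lerDl; apply: sumr_ge0 => l _.
  by have := (majorant_monotone k).1 i l; rewrite !mxE mulr1.
have [Y YY leY] := mx_monotone_cvg (fun k => (majorant_monotone k).2) bound.
exists Y; split=> //.
  apply: (@mx_cvg_unique _ _ _ (fun k => P *m Y_ k.+1 + Y_ k.+1 *m G)).
    by apply: mx_cvgD; apply: mx_cvgM; do ?exact: mx_cvg_cst; exact: mx_cvg_shift.
  rewrite (_ : (fun k => _) = (fun k => rhs (Y_ k))); last exact/funext.
  by do ?[apply: mx_cvgD | apply: mx_cvgM | exact: YY | exact: mx_cvg_cst].
apply: mx_cvg_le majorant_row_sum.
by apply: mx_cvgM => //; exact: mx_cvg_cst.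
Qed.

Lemma majorant_primal_vector (Y : 'M[R]_(m, n)) :
  mx_le (Y *m one n) (one m) -> mx_gt0 ((Dt - C *m Y) *m one n).
Proof.
move=> Y1; apply: (mx_gt0_le hD); rewrite [X in mx_le _ X]mulmxBl.
apply: mx_leD (mx_le_refl _) _.
apply/mx_subr_ge0; rewrite opprK addrC -mulmxA -mulmxBr.
by apply: mulmx_ge0 => //; apply/mx_subr_ge0.
Qed.

(** The equation for [Y] rewrites the second product as
    [(At 1 - B 1) + Y (Dt 1 - C 1)].  Its positivity upgrades [1 - Y 1 >= 0] to a
    strict inequality: at a zero entry the product could not be positive. *)
Lemma majorant_dual_vector Y :
  mx_le 0 Y -> P *m Y + Y *m G = rhs Y -> mx_le (Y *m one n) (one m) ->
  mx_gt0 (one m - Y *m one n) /\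
  mx_gt0 ((At - Y *m C) *m (one m - Y *m one n)).
Proof.
move=> Yge0 solY Y1.
have Fu : mx_gt0 ((At - Y *m C) *m (one m - Y *m one n)).
  have -> : (At - Y *m C) *m (one m - Y *m one n) =
    (At *m one m - B *m one n) + Y *m (Dt *m one n - C *m one m).
    have /(congr1 (mulmx^~ (one n))) := solY.
    rewrite /riccati_rhs !(mulmxBl, mulmxBr, mulmxDl) !mulmxA => /matrixP e.
    apply/matrixP => i j; move: (e i j).
    by generalize_products; rewrite !mxE; lra.
  apply: (mx_gt0_le hA); apply/mx_subr_ge0; rewrite addrC addKr.
  exact: mulmx_ge0 (mx_gt0W hD).
split=> // i j; have u0 : mx_le 0 (one m - Y *m one n) by apply/mx_subr_ge0.
rewrite lt_neqAle eq_sym; have := u0 i j; rewrite [in X in X -> _]mxE => ->.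
rewrite andbT; apply/negP => /eqP uij.
have ZF : Zmatrix (At - Y *m C).
  by apply: Zmatrix_sub; [exact: Zmatrix_sub|exact: mulmx_ge0].
by have := Zmatrix_mul_at_zero ZF u0 uij; rewrite leNgt Fu.
Qed.

(** With [u = 1 - Y 1], [v] a positive left vector for [Dt - C Y] and
    [W = u v], the gap between [P W + W G] and the linearized right-hand side at
    [W] is [((At - Y C) u) v + u (v (Dt - C Y))], which is positive. *)
Lemma majorant_contraction Y :
  mx_le 0 Y -> P *m Y + Y *m G = rhs Y -> mx_le (Y *m one n) (one m) ->
  exists r (W : 'M[R]_(m, n)), [/\ 0 < r < 1, mx_gt0 W &
    mx_le (riccati_increment A2 C D2 Y Y W) (r *: (P *m W + W *m G))].
Proof.
move=> Yge0 solY Y1; have [u0 Fu0] := majorant_dual_vector Yge0 solY Y1.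
set u := one m - _ in u0 Fu0.
have ZH : Zmatrix (Dt - C *m Y).
  by apply: Zmatrix_sub; [exact: Zmatrix_sub|exact: mulmx_ge0].
have [v [v0 vH0]] :=
  Mmatrix_left_vector ZH (@one_gt0 n) (majorant_primal_vector Y1).
pose W := u *m v.
have outer p q (x : 'cV[R]_p) (y : 'rV[R]_q) : mx_gt0 x -> mx_gt0 y ->
    mx_gt0 (x *m y).
  by move=> x0 y0 i j; rewrite mxE big_ord1 mulr_gt0.
have W0 : mx_gt0 W by exact: outer.
set LW := P *m W + W *m G.
set KW := riccati_increment A2 C D2 Y Y W.
have gap : mx_gt0 (LW - KW).
  have -> : LW - KW =
      (At - Y *m C) *m u *m v + u *m (v *m (Dt - C *m Y)).
    rewrite /LW /KW /riccati_increment /W !(mulmxBl, mulmxBr) !mulmxA; mx_abelian.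
  move=> i j; rewrite mxE addr_gt0 //; [exact: outer Fu0 v0 i j|].
  exact: outer u0 vH0 i j.
have [d /andP[d0 d1] dLW] := mx_gt0_margin LW gap.
exists (1 - d), W; split=> //; first by rewrite subr_gt0 d1 /= ltrBlDr ltrDl.
rewrite -/LW -/KW; clearbody LW KW => i j.
by have := dLW i j; rewrite !mxE mulrBl mul1r; lra.
Qed.

(** The error [Y - Y_ k.+1] solves a Sylvester equation whose right-hand side is the
    increment from [Y_ k] to [Y]; as [Y_ k <= Y], that is at most the
    linearization at [Y] applied to [Y - Y_ k]. *)
Lemma majorant_geometric Y :
  (forall k, mx_le (Y_ k) Y) ->
  P *m Y + Y *m G = rhs Y -> mx_le (Y *m one n) (one m) ->
  exists r (W : 'M[R]_(m, n)), [/\ 0 < r < 1, mx_gt0 W &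
    forall k, mx_le (Y - Y_ k) (r ^+ k *: W)].
Proof.
move=> leY solY Y1.
have Yge0 : mx_le 0 Y by rewrite -Y0.
have [r [W [r01 W0 KW]]] := majorant_contraction Yge0 solY Y1.
have /andP[r0 _] := r01.
have [d /andP[d0 _] dY] := mx_gt0_margin Y W0.
exists r, (d^-1 *: W); split=> //.
  by move=> i j; rewrite mxE mulr_gt0 // invr_gt0.
have scale_increment a E : riccati_increment A2 C D2 Y Y (a *: E) =
    a *: riccati_increment A2 C D2 Y Y E.
  by rewrite /riccati_increment -!(scalemxAl, scalemxAr) !scalerDr.
elim=> [|k IH].
  rewrite Y0 subr0 expr0 scale1r => i j; have := dY i j.
  by rewrite !mxE ler_pdivlMl.
apply: majorant_le.
have -> : P *m (Y - Y_ k.+1) + (Y - Y_ k.+1) *m G = rhs Y - rhs (Y_ k).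
  by rewrite -solY -YS !(mulmxBl, mulmxBr); mx_abelian.
rewrite riccati_rhsB.
have [Yk0 _] := majorant_monotone k.
have Ek0 : mx_le 0 (Y - Y_ k) by apply/mx_subr_ge0.
apply: mx_le_trans (riccati_increment_le Yge0 (mx_le_refl _) Yk0 (leY k) Ek0 IH) _.
rewrite !scalerA scale_increment -scalemxAr -scalemxAl -scalerDr => i j.
have c0 : 0 < r ^+ k / d by rewrite divr_gt0 // exprn_gt0.
have := KW i j; set KWij := riccati_increment _ _ _ _ _ _.
set LW := (P *m W + W *m G); clearbody KWij LW; rewrite !mxE -(ler_pM2l c0).
by rewrite exprS; congr (_ <= _); ring.
Qed.

End Majorant.

(** * The complex iteration *)

(** The Kronecker sum acts on [vec X] as [X |-> P X + X G]; its positive vector,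
    unstacked, is [U]. *)
Lemma kronecker_sylvester (R : realType) m n (P : 'M[R]_m) (G : 'M[R]_n) :
  nonsing_Mmatrix (1%:M *t P + G^T *t 1%:M : 'M[R]_(n * m)) ->
  exists2 U : 'M[R]_(m, n), mx_gt0 U & mx_gt0 (P *m U + U *m G).
Proof.
move=> [_ [u [u0 Su0]]].
exists (\matrix_(i, j) u (mxtens_index (j, i)) 0) => i j; first by rewrite mxE.
have := Su0 (mxtens_index (j, i)) 0; congr (_ < _).
rewrite mxE (reindex (@mxtens_index n m)) /=; last first.
  by exists (@mxtens_unindex n m) => k _; rewrite (mxtens_indexK, mxtens_unindexK).
pose F (l : 'I_n) (k : 'I_m) := (1%:M *t P + G^T *t 1%:M)
  (mxtens_index (j, i)) (mxtens_index (l, k)) * u (mxtens_index (l, k)) 0.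
rewrite (eq_bigr (fun lk => F lk.1 lk.2)) => [|[] //].
rewrite -(pair_bigA _ F) /F /=.
under eq_bigr do under eq_bigr do rewrite mxE !tensmxE mulrDl.
under eq_bigr do rewrite big_split /=.
rewrite big_split /= !mxE; congr (_ + _).
  rewrite (bigD1 j) //= [X in _ + X]big1 => [|l /negPf lj].
    by rewrite addr0; apply: eq_bigr => k _; rewrite !mxE eqxx mul1r.
  by rewrite big1 // => k _; rewrite !mxE eq_sym lj !mul0r.
apply: eq_bigr => l _; rewrite (bigD1 i) //= big1 => [|k /negPf ki].
  by rewrite addr0 !mxE eqxx mulr1 mulrC.
by rewrite !mxE eq_sym ki mulr0 mul0r.
Qed.

Lemma geometric_le0 (R : realType) p q (M N : 'M[R]_(p, q)) r :
  0 < r < 1 -> (forall k, mx_le M (r ^+ k *: N)) -> mx_le M 0.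
Proof.
move=> /andP[r0 r1] MN i j; rewrite mxE.
have : ((N i j * r ^+ k) @[k --> \oo] --> (0 : R))%classic.
  by apply: cvg_geometric; rewrite ger0_norm // ltW.
move/cvgr_to_ge; apply; apply: nearW => k.
by have := MN k i j; rewrite mxE mulrC.
Qed.

Section Iteration.
Variables (R : realType) (omega : R) (m n : nat).
Variables (A1 A2 : 'M[R[i]]_m) (B : 'M[R[i]]_(m, n)) (C : 'M[R[i]]_(n, m)).
Variables (D1 D2 : 'M[R[i]]_n).
Hypothesis omega01 : 0 <= omega <= 1.

Local Notation P := (comparison omega A1).
Local Notation G := (comparison omega D1).
Local Notation inc := (riccati_increment A2 C D2).
Local Notation inct := (riccati_increment (absmx A2) (absmx C) (absmx D2)).
Local Notation rhs := (riccati_rhs A2 B C D2).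
Local Notation rhst := (riccati_rhs (absmx A2) (absmx B) (absmx C) (absmx D2)).

Variable U : 'M[R]_(m, n).
Hypothesis U0 : mx_gt0 U.
Hypothesis LU0 : mx_gt0 (P *m U + U *m G).

Lemma sylvester_dominated (X : 'M[R[i]]_(m, n)) (Y : 'M[R]_(m, n)) :
  mx_le (absmx (A1 *m X + X *m D1)) (P *m Y + Y *m G) -> mx_le (absmx X) Y.
Proof.
move=> XY; apply: (sylvester_le (@comparison_Zmatrix _ _ _ A1)
  (@comparison_Zmatrix _ _ _ D1) U0 LU0).
exact: mx_le_trans (comparison_sylvester omega01 _ _ _) XY.
Qed.

Lemma absmx_increment X Y E :
  mx_le (absmx (inc X Y E)) (inct (absmx X) (absmx Y) (absmx E)).
Proof.
have tri (M1 M2 : 'M[R[i]]_(m, n)) N1 N2 : mx_le (absmx M1) N1 ->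
    mx_le (absmx M2) N2 -> mx_le (absmx (M1 + M2)) (N1 + N2).
  by move=> h1 h2; apply: mx_le_trans (absmxD _ _) (mx_leD h1 h2).
have tri3 (M1 : 'M[R[i]]_(m, n)) (M2 : 'M[R[i]]_(n, m)) (M3 : 'M[R[i]]_(m, n)) :
    mx_le (absmx (M1 *m M2 *m M3)) (absmx M1 *m absmx M2 *m absmx M3).
  exact: mx_le_trans (absmxM _ _) (mx_leMr (absmxM _ _) (absmx_ge0 _)).
by apply: (tri); apply: (tri); first [exact: absmxM | exact: (tri3)].
Qed.

Variables (X_ : nat -> 'M[R[i]]_(m, n)) (Y_ : nat -> 'M[R]_(m, n)).
Hypothesis X0 : X_ 0%N = 0.
Hypothesis XS : forall k, A1 *m X_ k.+1 + X_ k.+1 *m D1 = rhs (X_ k).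
Hypothesis Y0 : Y_ 0%N = 0.
Hypothesis YS : forall k, P *m Y_ k.+1 + Y_ k.+1 *m G = rhst (Y_ k).

(** Each step [X_(k+1) - X_k] solves a Sylvester equation whose right-hand side is
    the increment of [rhs] along the previous step; its modulus is at most the
    corresponding increment for [Y_], which is what [Y_(k+1) - Y_k] solves. *)
Lemma iteration_majorized k : mx_le (absmx (X_ k)) (Y_ k) /\
  mx_le (absmx (X_ k.+1 - X_ k)) (Y_ k.+1 - Y_ k).
Proof.
elim: k => [|k [Xk XkS]].
  rewrite X0 Y0 absmx0; split; first exact: mx_le_refl.
  rewrite !subr0; apply: sylvester_dominated; rewrite XS YS X0 Y0 /riccati_rhs.
  by rewrite !(mulmx0, mul0mx) !addr0; apply: mx_le_refl.
have XkS' : mx_le (absmx (X_ k.+1)) (Y_ k.+1).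
  rewrite -(subrK (X_ k) (X_ k.+1)) -(subrK (Y_ k) (Y_ k.+1)).
  exact: mx_le_trans (absmxD _ _) (mx_leD XkS Xk).
split=> //; apply: sylvester_dominated.
have -> : A1 *m (X_ k.+2 - X_ k.+1) + (X_ k.+2 - X_ k.+1) *m D1 =
    rhs (X_ k.+1) - rhs (X_ k) by rewrite -!XS !(mulmxBr, mulmxBl); mx_abelian.
have -> : P *m (Y_ k.+2 - Y_ k.+1) + (Y_ k.+2 - Y_ k.+1) *m G =
    rhst (Y_ k.+1) - rhst (Y_ k) by rewrite -!YS !(mulmxBr, mulmxBl); mx_abelian.
rewrite !riccati_rhsB; apply: mx_le_trans (absmx_increment _ _ _) _.
by apply: riccati_increment_le => //; apply: absmx_ge0.
Qed.

(** Replacing [X] by [X_ k] in the residual of [X] costs at most a multiple of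
    [r ^+ k], for every [k]. *)
Lemma iteration_limit X Y W r :
  0 < r < 1 -> (forall k, mx_le (Y_ k) Y) ->
  (forall k, mx_le (Y - Y_ k) (r ^+ k *: W)) ->
  (forall k, mx_le (absmx (X - X_ k)) ((Y - Y_ k) + (Y - Y_ k))) ->
  mx_le 0 W ->
  mx_le (absmx X) Y /\ A1 *m X + X *m D1 = rhs X.
Proof.
move=> r01 leY YW XY W0; have /andP[r0 r1] := r01.
have W2 k : mx_le (absmx (X - X_ k)) (r ^+ k *: (W + W)).
  by apply: mx_le_trans (XY k) _; rewrite scalerDr; apply: mx_leD.
have XleY : mx_le (absmx X) Y.
  apply/mx_subr_ge0; rewrite -opprB -sub0r; apply/mx_subr_ge0.
  apply: (geometric_le0 (N := W) r01) => k; apply: mx_le_trans (YW k).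
  have := mx_leD (iteration_majorized k).1 (XY k).
  have := absmxD (X_ k) (X - X_ k); rewrite addrC subrK => h1 h2 i j.
  by have := h1 i j; have := h2 i j; rewrite !mxE; lra.
split=> //; apply/eqP; rewrite -subr_eq0; apply/eqP/absmx_eq0.
apply: (geometric_le0 (N := absmx A1 *m (W + W) + (W + W) *m absmx D1 +
  inct Y Y (W + W)) r01) => k.
pose T := r ^+ k *: (W + W).
have WS : mx_le (absmx (X - X_ k.+1)) T.
  apply: mx_le_trans (W2 _) _ => i j; rewrite !mxE exprS -mulrA.
  apply: ler_piMl (ltW r1); apply: mulr_ge0; first exact: exprn_ge0 (ltW r0).
  by have := W0 i j; rewrite mxE; lra.
have -> : A1 *m X + X *m D1 - rhs X = A1 *m (X - X_ k.+1) +
    (X - X_ k.+1) *m D1 - inc X (X_ k) (X - X_ k).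
  by rewrite -(riccati_rhsB A2 B C D2) -XS !(mulmxBl, mulmxBr); mx_abelian.
apply: (@mx_le_trans _ _ _ (absmx A1 *m T + T *m absmx D1 + inct Y Y T)).
  apply: mx_le_trans (absmxB _ _) (mx_leD _ _).
    apply: mx_le_trans (absmxD _ _) (mx_leD _ _).
      apply: mx_le_trans (absmxM _ _) _.
      by apply: mx_leM => //; do ?[exact: absmx_ge0 | exact: mx_le_refl].
    by apply: mx_le_trans (absmxM _ _) (mx_leMr WS (absmx_ge0 _)).
  apply: mx_le_trans (absmx_increment _ _ _) _.
  apply: riccati_increment_le => //; do ?exact: absmx_ge0.
  exact: mx_le_trans (iteration_majorized k).1 (leY k).
apply: mx_le_eq; rewrite /T /riccati_increment.
by rewrite -!(scalemxAl, scalemxAr) !scalerDr.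
Qed.

End Iteration.

(** * Spectra and the extremal solution *)

(** Cayley-Hamilton: with the roots of the characteristic polynomial of [G]
    factored out one at a time, each [Z *m (G - r%:M)] solves the same Sylvester
    equation and can vanish only if [Z] does. *)
Lemma sylvester_spectrum_inj (K : closedFieldType) m n (F : 'M[K]_m)
    (G : 'M[K]_n) (Z : 'M[K]_(m, n)) :
  (forall r, eigenvalue G r -> forall V : 'M[K]_(m, n),
    (F + r%:M) *m V = 0 -> V = 0) ->
  F *m Z + Z *m G = 0 -> Z = 0.
Proof.
case: n G Z => [|n] G Z inj FZG; first exact: thinmx0.
have [s charE] := closed_field_poly_normal (char_poly G).
rewrite (monicP (char_poly_monic G)) scale1r in charE.
have s_eig r : r \in s -> eigenvalue G r.
  by rewrite eigenvalue_root_char charE root_prod_XsubC.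
have : Z *m horner_mx G (\prod_(r <- s) ('X - r%:P)) = 0.
  by rewrite -charE Cayley_Hamilton mulmx0.
elim: s s_eig Z FZG {charE} => [|r s IH] s_eig Z FZG.
  by rewrite big_nil rmorph1 mulmx1.
rewrite big_cons rmorphM rmorphB /= horner_mx_X horner_mx_C -mulmxE mulmxA.
have FZ : F *m Z = - (Z *m G) by apply/eqP; rewrite -addr_eq0 FZG.
move=> /IH Zr0; have {Zr0} : Z *m (G - r%:M) = 0.
  apply: Zr0 => [t ts|]; first by apply: s_eig; rewrite inE ts orbT.
  have comm : (G - r%:M) *m G = G *m (G - r%:M).
    by rewrite mulmxBl mulmxBr scalar_mxC.
  by rewrite mulmxA FZ -[Z *m _ *m G]mulmxA comm mulmxA mulNmx addNr.
rewrite mulmxBr mul_mx_scalar => /eqP; rewrite subr_eq0 => /eqP ZG.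
apply: (inj r); first by apply: s_eig; rewrite mem_head.
by rewrite mulmxDl FZ ZG mul_scalar_mx addNr.
Qed.

Section Extremal.
Variables (R : realType) (omega : R).
Hypothesis omega01 : 0 <= omega <= 1.

Lemma comparison_sub_gt0 p (M N : 'M[R[i]]_p) (S T : 'M[R]_p) (u : 'cV[R]_p) :
  mx_le S (comparison omega M) -> mx_le (absmx N) T -> mx_gt0 u ->
  mx_gt0 ((S - T) *m u) -> mx_gt0 (comparison omega (M - N) *m u).
Proof.
move=> SM NT u0 STu; apply: (mx_gt0_le STu); apply: mx_leMr (mx_gt0W u0).
apply: mx_le_trans (comparison_sub omega01 _ _) => i j.
by have := SM i j; have := NT i j; rewrite !mxE; lra.
Qed.

(** Gershgorin: an eigenvalue with nonpositive [omega_part] would leave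
    [M - lambda%:M] dominant, hence invertible. *)
Lemma comparison_eigenvalue p (M : 'M[R[i]]_p) (u : 'cV[R]_p) lambda :
  mx_gt0 u -> mx_gt0 (comparison omega M *m u) -> eigenvalue M lambda ->
  0 < omega_part omega lambda.
Proof.
move=> u0 Mu0 /eigenvalueP[v vM v0]; rewrite ltNge; apply/negP => l0.
have Munit : M + (- lambda)%:M \in unitmx.
  apply: inj_unitmx => X; apply: (comparison_shift_inj omega01 u0 Mu0).
  by rewrite omega_partN oppr_ge0.
move: v0; rewrite -(mulmxK Munit v) mulmxDr vM mul_mx_scalar scaleNr subrr.
by rewrite mul0mx eqxx.
Qed.

(** The difference [Z] of two solutions [X] and [Phi] satisfies
    [(A - Phi C) Z + Z (D - C X) = 0]. *)
Lemma extremal_unique m n (A : 'M[R[i]]_m) (B : 'M[R[i]]_(m, n))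
    (C : 'M[R[i]]_(n, m)) (D : 'M[R[i]]_n) (Phi X : 'M[R[i]]_(m, n))
    (u : 'cV[R]_m) :
  mx_gt0 u -> mx_gt0 (comparison omega (A - Phi *m C) *m u) ->
  is_solution A B C D Phi -> is_extremal omega A B C D X -> Phi = X.
Proof.
move=> u0 Fu0 solPhi [solX specX]; apply/eqP; rewrite eq_sym -subr_eq0; apply/eqP.
apply: (@sylvester_spectrum_inj _ _ _ (A - Phi *m C) (D - C *m X)).
  move=> r /specX r0 V.
  exact: (comparison_shift_inj omega01 u0 Fu0 (ltW r0)).
have e : (X *m C *m X - X *m D - A *m X + B) -
    (Phi *m C *m Phi - Phi *m D - A *m Phi + B) = 0.
  by move: solX solPhi; rewrite /is_solution => -> ->; rewrite subrr.
rewrite -oppr0 -[in RHS]e !(mulmxBl, mulmxBr) !mulmxA; mx_abelian.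
Qed.

End Extremal.

Theorem theorem5p1 (R : realType) (omega : R) (m n : nat)
    (A A1 A2 : 'M[R[i]]_m) (B : 'M[R[i]]_(m, n))
    (C : 'M[R[i]]_(n, m)) (D D1 D2 : 'M[R[i]]_n)
    (omega01 : 0 <= omega <= 1)
    (hH : class_H omega A B C D)
    (hQ1 : mx_gt0 (comparison omega (Qmx A B C D) *m (const_mx 1 : 'cV[R]_(n + m))))
    (hA : A = A1 - A2) (hD : D = D1 - D2)
    (At := comparison omega A1 - absmx A2)
    (Dt := comparison omega D1 - absmx D2)
    (Bt := absmx B) (Ct := absmx C)
    (Qt := Qmx At Bt Ct Dt)
    (hS : nonsing_Mmatrix
            (1%:M *t comparison omega A1 + (comparison omega D1)^T *t 1%:M :
               'M[R]_(n * m)))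
    (hQt : nonsing_Mmatrix Qt)
    (hQtQ : mx_le Qt (comparison omega (Qmx A B C D)))
    (hQt1 : mx_gt0 (Qt *m (const_mx 1 : 'cV[R]_(n + m)))) :
  exists (Phi : 'M[R[i]]_(m, n)) (Phi_ : nat -> 'M[R[i]]_(m, n)),
    [/\ unique (is_extremal omega A B C D) Phi,
        unique (is_iteration A1 A2 B C D1 D2) Phi_
      & linearly_converges Phi_ Phi].
Proof.
have [U U0 LU0] := kronecker_sylvester hS.
pose ZP := @comparison_Zmatrix R omega m A1.
pose ZG := @comparison_Zmatrix R omega n D1.
pose A20 := absmx_ge0 A2; pose B0 := absmx_ge0 B.
pose C0 := absmx_ge0 C; pose D20 := absmx_ge0 D2.
have rows : Qt *m (const_mx 1 : 'cV[R]_(n + m)) = col_mx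
    (Dt *m const_mx 1 - Ct *m const_mx 1) (At *m const_mx 1 - Bt *m const_mx 1).
  rewrite -col_mx_const mul_block_col !mulNmx; congr col_mx.
  by rewrite addrC.
have hAt : mx_gt0 (At *m (const_mx 1 : 'cV_m) - Bt *m (const_mx 1 : 'cV_n)).
  by move=> i j; have := hQt1 (rshift n i) j; rewrite rows col_mxEd.
have hDt : mx_gt0 (Dt *m (const_mx 1 : 'cV_n) - Ct *m (const_mx 1 : 'cV_m)).
  by move=> i j; have := hQt1 (lshift m i) j; rewrite rows col_mxEu.
have complex_inj (X : 'M[R[i]]_(m, n)) : A1 *m X + X *m D1 = 0 -> X = 0.
  move=> AX0; apply: absmx_eq0; apply: (sylvester_dominated omega01 U0 LU0).
  by rewrite AX0 absmx0 mulmx0 mul0mx addr0; exact: mx_le_refl.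
have [S SP] := sylvester_inverse complex_inj.
have real_inj X := sylvester_inj (X := X) ZP ZG U0 LU0.
have [St StP] := sylvester_inverse real_inj.
pose X_ k := iter k (S \o riccati_rhs A2 B C D2) 0.
pose Y_ k :=
  iter k (St \o riccati_rhs (absmx A2) (absmx B) (absmx C) (absmx D2)) 0.
have XS k : A1 *m X_ k.+1 + X_ k.+1 *m D1 = riccati_rhs A2 B C D2 (X_ k).
  by rewrite SP.
have YS k : comparison omega A1 *m Y_ k.+1 + Y_ k.+1 *m comparison omega D1 =
    riccati_rhs (absmx A2) (absmx B) (absmx C) (absmx D2) (Y_ k) by rewrite StP.
have [Y [YY leY solY Y1]] := majorant_limit ZP ZG A20 B0 C0 D20 U0 LU0 hAt hDt
  (erefl : Y_ 0%N = 0) YS.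
have Y0 : mx_le 0 Y by exact: leY 0%N.
have [r [W [r01 W0 YW]]] := majorant_geometric ZP ZG A20 B0 C0 D20 U0 LU0 hAt hDt
  (erefl : Y_ 0%N = 0) YS leY solY Y1.
have [u0 Fu0] := majorant_dual_vector ZP A20 C0 hAt hDt Y0 solY Y1.
have major := iteration_majorized omega01 U0 LU0
  (erefl : X_ 0%N = 0) XS (erefl : Y_ 0%N = 0) YS.
have [Phi PhiY] := majorized_cvg (fun k => (major k).2) YY.
have [Phi_le solPhi] := iteration_limit omega01 U0 LU0
  (erefl : X_ 0%N = 0) XS (erefl : Y_ 0%N = 0) YS r01 leY YW PhiY (mx_gt0W W0).
have hAtA : mx_le At (comparison omega A) by rewrite hA; exact: comparison_sub.
have hDtD : mx_le Dt (comparison omega D) by rewrite hD; exact: comparison_sub.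
have one0 : mx_gt0 (const_mx 1 : 'cV[R]_n) := @one_gt0 R n.
have FPhi : mx_gt0 (comparison omega (A - Phi *m C) *m
    (const_mx 1 - Y *m const_mx 1 : 'cV[R]_m)).
  apply: (comparison_sub_gt0 omega01 hAtA _ u0 Fu0).
  exact: mx_le_trans (absmxM _ _) (mx_leMr Phi_le C0).
have HPhi : mx_gt0 (comparison omega (D - C *m Phi) *m (const_mx 1 : 'cV[R]_n)).
  apply: (comparison_sub_gt0 omega01 (S := Dt) (T := absmx C *m Y)) => //.
    apply: mx_le_trans (absmxM _ _) _.
    by apply: mx_leM => //; exact: absmx_ge0.
  exact: majorant_primal_vector.
have Phi_sol : is_solution A B C D Phi.
  have /(congr1 -%R) := subrr (riccati_rhs A2 B C D2 Phi).
  rewrite -[X in - (X - _)]solPhi oppr0 /is_solution hA hD /riccati_rhs => <-.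
  by rewrite !(mulmxBl, mulmxBr); mx_abelian.
exists Phi, X_; split.
- split=> [|X exX]; last exact: (extremal_unique omega01 u0 FPhi Phi_sol exX).
  split=> // lambda ev; exact: (comparison_eigenvalue omega01 one0 HPhi ev).
- split=> [|X' [X'0 X'S]]; first by split.
  apply/funext; elim=> [|k IH]; first by rewrite X'0.
  apply/eqP; rewrite -subr_eq0; apply/eqP/complex_inj.
  have := XS k; rewrite IH -[RHS]X'S => /eqP; rewrite -subr_eq0 => /eqP <-.
  by rewrite !(mulmxBl, mulmxBr); mx_abelian.
- apply: (geometric_linearly_converges (W := W + W) r01) => k.
  apply: mx_le_trans (PhiY k) _; rewrite scalerDr; exact: mx_leD.
Qed.
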